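(* Let $R>r>0$ and let $\mathcal{K}^*_{\partial\Omega}$ be the Neumann–Poincaré operator on the Hilbert space $K^{-1/2}_0$ as described in the context. Then $\mathcal{K}^*_{\partial\Omega}$ has only absolutely continuous spectrum, and its spectrum is $[-1/2,1/2]$.
   Context: Identify $\mathbb{R}^2$ with $\mathbb{C}$; for $a\in\mathbb{R}\setminus\{0\}$ let $B_a$ be the open disk of radius $|a|$ centered at $(a,0)$. Fix $R>r>0$, let $\Omega=B_R\setminus\overline{B_r}$ (crescent domain), and put $q=\frac{1}{2r}-\frac{1}{2R}>0$. For $k\neq0$ let $\mathbb{S}(k)=\frac{1}{2|k|}\mathrm{diag}(1-e^{-|k|q},\,1+e^{-|k|q})$ and $\mathbb{K}(k)=\frac12e^{-|k|q}\mathrm{diag}(-1,1)$. $K^{-1/2}_0$ is the Hilbert space of pairs $\hat\varphi=(\hat\varphi_1,\hat\varphi_2)^T$ of measurable complex functions on $\mathbb{R}$ (mod a.e.) with $\int_{\mathbb{R}}\hat\varphi^T\mathbb{S}\overline{\hat\varphi}\,dk<\infty$, inner product $\langle\psi,\varphi\rangle_{-1/2}=\int_{\mathbb{R}}\hat\psi^T\mathbb{S}\overline{\hat\varphi}\,dk$. (In the paper such a pair represents the boundary density $\varphi=U^{-1}P\hat\varphi$ on $\partial\Omega$, with $P=\frac1{\sqrt2}\begin{bmatrix}-1&1\\1&1\end{bmatrix}$ and $U$ the Fourier transform of the density pulled back by $z\mapsto1/z$ to the two vertical lines bounding the image strip.) The Neumann–Poincaré operator $\mathcal{K}^*_{\partial\Omega}$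 on $K^{-1/2}_0$ is the multiplication operator $\hat\varphi\mapsto\mathbb{K}\hat\varphi$. *)

(* Defs.v *)
From HB Require Import structures.
From mathcomp Require Import all_boot all_order all_algebra.
From mathcomp Require Import all_classical all_reals all_analysis.
From mathcomp Require Import complex.

Set Implicit Arguments.
Unset Strict Implicit.
Unset Printing Implicit Defensive.

Import Order.TTheory GRing.Theory Num.Theory.
Import numFieldNormedType.Exports.
Local Open Scope classical_set_scope.
Local Open Scope ring_scope.

Section NP.
Variable R : realType.

Local Notation C := (R[i]).
Local Notation leb := (@lebesgue_measure R).

Definition qpar (r Rad : R) : R := (2 * r)^-1 - (2 * Rad)^-1.

(* diagonal entries of S(k) and K(k) *)
Definition S1 (q k : R) : R := (1 - expR (- (`|k| * q))) / (2 * `|k|).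
Definition S2 (q k : R) : R := (1 + expR (- (`|k| * q))) / (2 * `|k|).
Definition K1 (q k : R) : R := - (expR (- (`|k| * q)) / 2).
Definition K2 (q k : R) : R := expR (- (`|k| * q)) / 2.

Definition csq (z : C) : R := complex.Re z ^+ 2 + complex.Im z ^+ 2.
Definition rc (x : R) : C := Complex x 0.
Definition cconj (z : C) : C := Complex (complex.Re z) (- complex.Im z).

Definition pairfun := R -> C * C.

Definition cmeasurable (f : R -> C) :=
  measurable_fun setT (fun k => complex.Re (f k)) /\ measurable_fun setT (fun k => complex.Im (f k)).

(* membership in K^{-1/2}_0 (representatives; elements are taken mod a.e.) *)
Definition inK (q : R) (phi : pairfun) : Prop :=
  cmeasurable (fun k => (phi k).1) /\ cmeasurable (fun k => (phi k).2) /\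
  (\int[leb]_(k in setT)
     ((S1 q k * csq (phi k).1 + S2 q k * csq (phi k).2)%:E) < +oo)%E.

Definition aeeq (phi psi : pairfun) : Prop :=
  {ae leb, forall k, phi k = psi k}.

Definition cint d (T : measurableType d) (mu : {measure set T -> \bar R})
    (f : T -> C) : C :=
  Complex (Rintegral mu setT (fun k => complex.Re (f k)))
          (Rintegral mu setT (fun k => complex.Im (f k))).

Definition ipK (q : R) (psi phi : pairfun) : C :=
  cint leb (fun k => rc (S1 q k) * (psi k).1 * cconj (phi k).1
                   + rc (S2 q k) * (psi k).2 * cconj (phi k).2).

Definition NPop (q : R) (phi : pairfun) : pairfun :=
  fun k => (rc (K1 q k) * (phi k).1, rc (K2 q k) * (phi k).2).

Definition NPshift (q : R) (z : C) (psi : pairfun) : pairfun :=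
  fun k => ((NPop q psi k).1 - z * (psi k).1, (NPop q psi k).2 - z * (psi k).2).

Definition zerofun : pairfun := fun _ => (0, 0).

(* z is in the resolvent set: NP - z is a bijection of K^{-1/2}_0
   (for the bounded operator NP, bounded inverse is then automatic) *)
Definition resolvent_point (q : R) (z : C) : Prop :=
  (forall psi, inK q psi -> aeeq (NPshift q z psi) zerofun -> aeeq psi zerofun) /\
  (forall phi, inK q phi -> exists psi, inK q psi /\ aeeq (NPshift q z psi) phi).

Definition NPspectrum (q : R) : set C := [set z | ~ resolvent_point q z].

(* mu is the spectral measure of phi: for every nonreal z,
   <(NP - z)^{-1} phi, phi> = int dmu(t) / (t - z) *)
Definition is_spectral_measure (q : R) (phi : pairfun)
    (mu : {finite_measure set R -> \bar R}) : Prop :=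
  forall z : C, complex.Im z != 0 -> forall psi, inK q psi ->
    aeeq (NPshift q z psi) phi ->
    ipK q psi phi = cint mu (fun t => (rc t - z)^-1).

(* only absolutely continuous spectrum: every spectral measure is
   absolutely continuous w.r.t. Lebesgue measure (H = H_ac) *)
Definition only_ac_spectrum (q : R) : Prop :=
  forall phi, inK q phi ->
    exists mu : {finite_measure set R -> \bar R},
      is_spectral_measure q phi mu /\ mu `<< leb.

End NP.

(* Main.v *)
(** The operator is multiplication by the even functions [K1 <= 0 <= K2] of
    modulus [exp (-|k| q) / 2]; the closures of their ranges fill [-1/2, 1/2].

    Off this interval [(K - z)^-1] is bounded, so [z] is in the resolvent set.
    For real [t] in it there is a weight [w >= 0] with [\int w = +oo] but
    [\int (K - t)^2 w < +oo]; then [(K - t) sqrt (w / S)] lies in the space but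
    its only preimage under [K - t], which is [sqrt (w / S)], does not.

    The spectral measure of [phi] is the sum over [j] of the push-forward of
    [S_j |phi_j|^2 dk] along [K_j]. It is absolutely continuous because, on each
    [[0, n]] and [[-n, 0]], [K_j] expands distances by a factor bounded below,
    so preimages of null sets are null. *)

Require Import Defs.
From HB Require Import structures.
From mathcomp Require Import all_boot all_order all_algebra.
From mathcomp Require Import all_classical all_reals all_analysis.
From mathcomp Require Import measurable_realfun.
From mathcomp Require Import complex.
From mathcomp Require Import ring lra.
Set Implicit Arguments.
Unset Strict Implicit.
Unset Printing Implicit Defensive.

Import Order.TTheory GRing.Theory Num.Theory.
Import numFieldNormedType.Exports.
Local Open Scope classical_set_scope.
Local Open Scope ring_scope.

(** * Finite measures given by densities, and their push-forwards *)

(** An alias of [m] that carries the proof of finite total mass, so that a finite-measure structure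
    can be attached to it. *)
Definition bounded_measure d (T : measurableType d) (R : realType)
    (m : {measure set T -> \bar R}) of (m setT < +oo)%E : set T -> \bar R := m.

Section bounded_measure.
Context d (T : measurableType d) (R : realType) (m : {measure set T -> \bar R}).
Hypothesis moo : (m setT < +oo)%E.

HB.instance Definition _ := Measure.on (bounded_measure moo).

Let fin : fin_num_fun (bounded_measure moo).
Proof.
move=> A mA; rewrite ge0_fin_numE; last exact: measure_ge0.
by apply: le_lt_trans moo; apply: le_measure; rewrite ?inE.
Qed.

HB.instance Definition _ := Measure_isFinite.Build _ _ _ (bounded_measure moo) fin.

End bounded_measure.

(** The charge induced by [F] is nonnegative, hence a finite measure. The integral formula is the
    Radon-Nikodym change of variables, once the derivative is identified with [F]. *)
Lemma density_measure d (T : measurableType d) (R : realType)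
    (mu : {sigma_finite_measure set T -> \bar R}) (F : T -> \bar R)
    (intF : mu.-integrable setT F) (F0 : forall x, (0 <= F x)%E) :
  exists nu : {finite_measure set T -> \bar R}, nu `<< mu /\
    forall g : T -> \bar R, nu.-integrable setT g ->
      (\int[nu]_x g x = \int[mu]_x (g x * F x))%E.
Proof.
have pos (A : set T) : (0 <= induced_charge intF A)%E by exact: integral_ge0.
pose nu0 : {measure set T -> \bar R} := measure_of_charge (induced_charge intF) pos.
have noo : (nu0 setT < +oo)%E.
  by rewrite -ge0_fin_numE //; exact: (@fin_num_measure _ _ _ (induced_charge intF)).
pose nu : {finite_measure set T -> \bar R} := bounded_measure noo.
have nuE A : nu A = (\int[mu]_(x in A) F x)%E by [].
have mF : measurable_fun setT F by exact: measurable_int intF.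
have ac : nu `<< mu.
  apply/null_content_dominatesP => A mA muA; rewrite nuE.
  by apply: null_set_integral => //; exact: measurable_funTS.
exists nu; split => // g intg.
rewrite -(Radon_Nikodym_change_of_variables ac measurableT intg).
have mg := measurable_int _ intg.
apply: ae_eq_integral => //; [exact: emeasurable_funM|exact: emeasurable_funM|].
(* The derivative and [F] have the same integral over every measurable set, so they agree almost
   everywhere. *)
apply: ae_eqe_mul2l; apply: integral_ae_eq => //.
  exact: Radon_Nikodym_integrable.
by move=> A _ mA; rewrite -Radon_Nikodym_integral// -nuE.
Qed.

(** [nu] is the sum of the images of [F1 mu] under [f1] and of [F2 mu] under [f2]. The hypotheses
    [nf1] and [nf2] transfer absolute continuity from [mu] to Lebesgue measure; boundedness of [g]
    gives integrability against finite measures. *)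
Lemma pushforward_density2 d (T : measurableType d) (R : realType)
    (mu : {sigma_finite_measure set T -> \bar R}) (F1 F2 : T -> \bar R)
    (f1 f2 : T -> R)
    (intF1 : mu.-integrable setT F1) (intF2 : mu.-integrable setT F2)
    (F10 : forall x, (0 <= F1 x)%E) (F20 : forall x, (0 <= F2 x)%E)
    (mf1 : measurable_fun setT f1) (mf2 : measurable_fun setT f2)
    (nf1 : forall A : set R, measurable A -> lebesgue_measure A = 0 ->
       mu (f1 @^-1` A) = 0%E)
    (nf2 : forall A : set R, measurable A -> lebesgue_measure A = 0 ->
       mu (f2 @^-1` A) = 0%E) :
  exists nu : {finite_measure set R -> \bar R}, nu `<< (@lebesgue_measure R) /\
    forall g : R -> R, measurable_fun setT g ->
      [bounded g x | x in [set: R]] ->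
      (\int[nu]_x (g x)%:E =
       \int[mu]_x ((g (f1 x))%:E * F1 x + (g (f2 x))%:E * F2 x))%E.
Proof.
have [m1 [ac1 E1]] := density_measure intF1 F10.
have [m2 [ac2 E2]] := density_measure intF2 F20.
unshelve epose (p1 := (pushforward m1 f1 : {measure set R -> \bar R})); first exact: mf1.
unshelve epose (p2 := (pushforward m2 f2 : {measure set R -> \bar R})); first exact: mf2.
have poo : (measure_add p1 p2 setT < +oo)%E.
  rewrite measure_addE /= /pushforward !preimage_setT.
  by apply: lte_add_pinfty; rewrite -ge0_fin_numE ?measure_ge0 // fin_num_measure.
pose nu : {finite_measure set R -> \bar R} := bounded_measure poo.
have nuE A : nu A = measure_add p1 p2 A by [].
exists nu; split.
  apply/null_content_dominatesP => A mA A0.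
  rewrite nuE measure_addE /= /pushforward.
  have mA1 : measurable (f1 @^-1` A) by rewrite -[X in measurable X]setTI; exact: (mf1).
  have mA2 : measurable (f2 @^-1` A) by rewrite -[X in measurable X]setTI; exact: (mf2).
  move/null_content_dominatesP : ac1 => ->//; last exact: nf1.
  move/null_content_dominatesP : ac2 => ->//; last exact: nf2.
  by rewrite adde0.
move=> g mg bg.
have bgf (f : T -> R) : [bounded g (f x) | x in [set: T]].
  case: bg => M [Mr bM]; exists M; split => // x Mx y _; exact: bM.
have i1 : m1.-integrable setT (EFin \o g \o f1).
  apply: (@measurable_bounded_integrable _ _ _ m1 (g \o f1)) => //.
  - by rewrite -ge0_fin_numE // fin_num_measure.
  - exact: measurableT_comp.
  - exact: bgf.
have i2 : m2.-integrable setT (EFin \o g \o f2).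
  apply: (@measurable_bounded_integrable _ _ _ m2 (g \o f2)) => //.
  - by rewrite -ge0_fin_numE // fin_num_measure.
  - exact: measurableT_comp.
  - exact: bgf.
have mEg : measurable_fun setT (EFin \o g) by exact/measurable_EFinP.
rewrite (eq_measure_integral (measure_add p1 p2)); last by move=> A _ _; exact: nuE.
rewrite integral_measure_add //; last 2 first.
- exact: (integrable_pushforward mf1).
- exact: (integrable_pushforward mf2).
rewrite (integral_pushforward mf1 mEg) //.
rewrite (integral_pushforward mf2 mEg) //.
rewrite !preimage_setT E1 // E2 // -integralD //.
- apply: (@integrableMr _ _ _ mu setT measurableT (g \o f1)) => //;
    [exact: measurableT_comp|exact: bgf].
- apply: (@integrableMr _ _ _ mu setT measurableT (g \o f2)) => //;
    [exact: measurableT_comp|exact: bgf].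
Qed.

(** * Null sets under maps that expand distances *)

Section null_preimage.
Variable R : realType.
Local Notation leb := (@lebesgue_measure R).

(** Once the preimage contains a point [x0], it lies within distance [(b - a) / c] of [x0]. The
    factor 2 is the passage from radius to length. Here [leb] acts as an outer measure. *)
Lemma preimage_itv_measure_le (f : R -> R) (D : set R) (c a b : R) : 0 < c ->
    a <= b ->
    (forall x y, D x -> D y -> c * `|x - y| <= `|f x - f y|) ->
  (leb (D `&` f @^-1` `]a, b]) <= (2 / c)%:E * (b - a)%:E)%E.
Proof.
move=> c0 ab fD.
have [->|/set0P[x0 [Dx0 fx0]]] := eqVneq (D `&` f @^-1` `]a, b]%classic) set0.
  by rewrite measure0 -EFinM lee_fin mulr_ge0 ?subr_ge0// divr_ge0// ltW.
pose r := (b - a) / c.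
apply: (@le_trans _ _ (leb `[x0 - r, x0 + r]%classic)).
  apply: (le_outer_measure leb) => x [Dx fx] /=.
  have := fD _ _ Dx Dx0; move: fx0 fx; rewrite /= !in_itv/=.
  move=> /andP[a0 b0] /andP[a1 b1].
  rewrite -ler_distl => fxy; rewrite /r ler_pdivlMr// mulrC (le_trans fxy)//.
  by rewrite ler_norml; apply/andP; split; lra.
rewrite lebesgue_measure_itv/= lte_fin; case: ifPn => _.
  by rewrite -EFinD -EFinM lee_fin /r; lra.
by rewrite -EFinM lee_fin mulr_ge0 ?subr_ge0// divr_ge0// ltW.
Qed.

(** Cover [A] by half-open intervals of small total length; pulling them back multiplies the total
    by at most [2 / c]. *)
Lemma preimage_null (f : R -> R) (D A : set R) (c : R) : 0 < c ->
    (forall x y, D x -> D y -> c * `|x - y| <= `|f x - f y|) ->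
  (leb A = 0 -> leb (D `&` f @^-1` A) = 0)%E.
Proof.
move=> c0 fD A0; apply/eqP; rewrite eq_le outer_measure_ge0 andbT.
apply/lee_addgt0Pr => e e0; rewrite add0e.
(* This total length is chosen so that the factor [2 / c] turns it into [e]. *)
have d0 : 0 < e * c / 2 by rewrite divr_gt0// mulr_gt0.
have : (leb A < (e * c / 2)%:E)%E by rewrite A0 lte_fin.
(* Unfolding exposes [leb A] as an infimum over countable covers by half-open intervals, from which
   a cover [F] is extracted. *)
rewrite /lebesgue_measure /lebesgue_stieltjes_measure /measure_extension /mu_ext.
move=> /ereal_inf_lt[_ [F [mF AF] <-]] sF.
apply: (@le_trans _ _ (\sum_(0 <= k <oo) leb (D `&` f @^-1` (F k)))%E).
  apply: (@le_trans _ _ (leb (\bigcup_k (D `&` f @^-1` (F k))))).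
    apply: (le_outer_measure leb) => x [Dx /AF[k _ Fk]].
    by exists k.
  exact: (outer_measure_sigma_subadditive leb).
apply: (@le_trans _ _ (\sum_(0 <= k <oo) ((2 / c)%:E * wlength idfun (F k)))%E).
  apply: lee_nneseries => k; first by move=> _ _; exact: (outer_measure_ge0 leb).
  move=> _.
  move: (mF k) => /ocitvP[->|[[a b] /= ab ->]].
    by rewrite preimage_set0 setI0 measure0 wlength0 mule0.
  rewrite wlength_itv_bnd; last exact: ltW.
  by apply: preimage_itv_measure_le => //; exact: ltW.
rewrite nneseriesZl; last by move=> i _; exact: measure_ge0.
have -> : e = (2 / c) * (e * c / 2) by field; rewrite gt_eqF.
by rewrite [leRHS]EFinM; apply: lee_wpmul2l; [rewrite lee_fin divr_ge0// ltW|exact: ltW].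
Qed.

End null_preimage.

(** * Slope bounds for the exponential, and null preimages for functions controlled by it *)

Section exponential_profile.
Variable R : realType.
Local Notation leb := (@lebesgue_measure R).

(** Factor out [expR (- b)], which is at least [expR (- M)], and use [1 + x <= expR x] at
    [x = b - a]. *)
Lemma expR_sub_ge (M a b : R) : a <= b -> b <= M ->
  expR (- M) * (b - a) <= expR (- a) - expR (- b).
Proof.
move=> ab bM.
have -> : expR (- a) - expR (- b) = expR (- b) * (expR (b - a) - 1).
  by rewrite mulrBr mulr1 -expRD; congr (expR _ - _); ring.
apply: ler_pM; rewrite ?expR_ge0 ?subr_ge0 ?ler_expR ?lerN2//.
by have := expR_ge1Dx (b - a); lra.
Qed.

(** Factor out [expR (- a) <= 1] and use [1 + x <= expR x] at [x = a - b]. *)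
Lemma expR_sub_le (a b : R) : 0 <= a -> a <= b ->
  expR (- a) - expR (- b) <= b - a.
Proof.
move=> a0 ab.
have -> : expR (- a) - expR (- b) = expR (- a) * (1 - expR (a - b)).
  by rewrite mulrBr mulr1 -expRD; congr (_ - expR _); ring.
have e1 : expR (- a) <= 1 by rewrite -[leRHS]expR0 ler_expR; lra.
have e2 : expR (a - b) <= 1 by rewrite -[leRHS]expR0 ler_expR; lra.
have e3 := expR_ge1Dx (a - b).
have e4 := expR_ge0 (- a).
by apply: (@le_trans _ _ (1 * (1 - expR (a - b)))); [apply: ler_pM; lra|lra].
Qed.

(** The slope of the profile degenerates at infinity and its evenness folds the line at 0. So the
    line is cut into the countably many pieces [[0, n]] and [[-n, 0]], on each of which [f] expands
    distances by a fixed factor. *)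
Lemma exp_nonsingular (q c : R) (f : R -> R) (A : set R) : 0 < q -> 0 < c ->
    (forall x y, c * `|expR (- (`|x| * q)) - expR (- (`|y| * q))|
       <= `|f x - f y|) ->
    leb A = 0%E ->
  leb (f @^-1` A) = 0%E.
Proof.
move=> q0 c0 fE A0.
have key n (D : set R) : (forall x, D x -> `|x| <= n%:R) ->
    (forall x y, D x -> D y -> `|x - y| = `| `|x| - `|y| |) ->
    leb (D `&` f @^-1` A) = 0%E.
  move=> Dn Dd.
  (* The expansion factor on [D]: [expR (- s)] has slope at least [expR (- (n q))] in size for
     [s <= n q], and [s = |x| q] contributes [q]. *)
  have d0 : 0 < c * (expR (- (n%:R * q)) * q) by rewrite !mulr_gt0// expR_gt0.
  apply: (preimage_null d0) A0 => x y Dx Dy.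
  apply: le_trans (fE x y); rewrite -mulrA ler_pM2l// Dd//.
  have [nx ny] := (Dn _ Dx, Dn _ Dy).
  clear Dx Dy; move: nx ny; move: `|x| `|y| => {}x {}y.
  wlog : x y / x <= y.
    move=> h; have [xy|/ltW yx] := leP x y; first exact: h.
    by move=> ? ?; rewrite distrC [leRHS]distrC; exact: h.
  move=> xy xn yn.
  have xyq : x * q <= y * q by rewrite ler_pM2r.
  have ynq : y * q <= n%:R * q by rewrite ler_pM2r.
  have := expR_sub_ge xyq ynq.
  rewrite distrC ger0_norm ?subr_ge0// -mulrBl => h.
  by apply: le_trans (ler_norm _); apply: le_trans h; lra.
have cover : f @^-1` A `<=` \bigcup_n ((`[0, n%:R] `&` f @^-1` A) `|`
    (`[- n%:R, 0] `&` f @^-1` A)).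
  move=> x Ax; have [n nx] : exists n, `|x| <= n%:R.
    by exists (Num.trunc `|x|).+1; rewrite ltW// truncnS_gt.
  exists n => //; have [x0|/ltW x0] := leP 0 x; [left|right]; split => //=.
    by rewrite in_itv/= x0 -(ger0_norm x0).
  by rewrite in_itv/= x0 andbT lerNl -(ler0_norm x0).
apply/eqP; rewrite eq_le outer_measure_ge0 andbT.
apply: (le_trans (le_outer_measure leb _ _ cover)).
apply: (le_trans (outer_measure_sigma_subadditive leb _)).
rewrite eseries0// => n _ _; apply/eqP; rewrite eq_le outer_measure_ge0 andbT.
apply: (le_trans (outer_measureU2 leb _ _)).
have -> : 0%E = (0 + 0 : \bar R)%E by rewrite adde0.
apply: leeD; rewrite le_eqVlt; apply/orP; left; apply/eqP; apply: (key n).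
- by move=> x /=; rewrite in_itv/= => /andP[x0 xn]; rewrite ger0_norm.
- move=> x y /=; rewrite !in_itv/= => /andP[x0 _] /andP[y0 _].
  by rewrite (ger0_norm x0) (ger0_norm y0).
- by move=> x /=; rewrite in_itv/= => /andP[x0 xn]; rewrite ler0_norm// lerNl.
- move=> x y /=; rewrite !in_itv/= => /andP[_ x0] /andP[_ y0].
  by rewrite (ler0_norm x0) (ler0_norm y0) -opprD normrN.
Qed.

End exponential_profile.

(** * Squared modulus, and measurability of complex functions *)

Section complex_functions.
Variable R : realType.
Implicit Types z w : R[i].

Lemma complex_ReD z w : complex.Re (z + w) = complex.Re z + complex.Re w.
Proof. by case: z w => [a b] [c d]. Qed.

Lemma complex_ImD z w : complex.Im (z + w) = complex.Im z + complex.Im w.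
Proof. by case: z w => [a b] [c d]. Qed.

Lemma complex_ReM z w : complex.Re (z * w) =
  complex.Re z * complex.Re w - complex.Im z * complex.Im w.
Proof. by case: z w => [a b] [c d]. Qed.

Lemma complex_ImM z w : complex.Im (z * w) =
  complex.Re z * complex.Im w + complex.Im z * complex.Re w.
Proof. by case: z w => [a b] [c d]. Qed.

Lemma complex_ReV z : complex.Re z^-1 = complex.Re z / csq z.
Proof. by case: z. Qed.

Lemma complex_ImV z : complex.Im z^-1 = - (complex.Im z / csq z).
Proof. by case: z. Qed.

Lemma csq_ge0 z : 0 <= csq z.
Proof. by rewrite addr_ge0 ?sqr_ge0. Qed.

Lemma csq_eq0 z : (csq z == 0) = (z == 0).
Proof. by rewrite paddr_eq0 ?sqr_ge0// !sqrf_eq0 eq_complex. Qed.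

Lemma csq0 : csq (0 : R[i]) = 0.
Proof. by apply/eqP; rewrite csq_eq0. Qed.

Lemma csqM z w : csq (z * w) = csq z * csq w.
Proof. by rewrite /csq complex_ReM complex_ImM; ring. Qed.

Lemma csqV z : csq z^-1 = (csq z)^-1.
Proof.
have [->|z0] := eqVneq z 0; first by rewrite invr0 /csq/= expr0n/= addr0 invr0.
have z1 : csq z != 0 by rewrite csq_eq0.
apply: (mulfI z1); rewrite -csqM (divff z0) (divff z1) /csq/=.
by rewrite expr1n expr0n/= addr0.
Qed.

Lemma csq_rc (a : R) : csq (rc a) = a ^+ 2.
Proof. by rewrite /csq/= expr0n/= addr0. Qed.

Lemma mul_cconj z : z * cconj z = rc (csq z).
Proof.
case: z => a b; apply/eqP; rewrite eq_complex /csq/=.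
by apply/andP; split; apply/eqP; ring.
Qed.

Lemma csq_ge_Re z : `|complex.Re z| ^+ 2 <= csq z.
Proof. by rewrite real_normK ?num_real// lerDl sqr_ge0. Qed.

Lemma csq_ge_Im z : `|complex.Im z| ^+ 2 <= csq z.
Proof. by rewrite real_normK ?num_real// lerDr sqr_ge0. Qed.

(** Writing [1/x] as [x] times the square of the real power [|x|^(-1)] reduces the claim to
    measurability of power functions. At 0 both sides vanish, since [0^-1 = 0]. *)
Lemma measurable_funV d (T : measurableType d) (f : T -> R) :
  measurable_fun setT f -> measurable_fun setT (fun x => (f x)^-1).
Proof.
move=> mf.
have -> : (fun x => (f x)^-1) = (fun x => f x * (`|f x| `^ (-1)) ^+ 2).
  apply/funext => x; rewrite powR_inv1// exprVn real_normK ?num_real//.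
  have [->|fx0] := eqVneq (f x) 0; first by rewrite invr0 mul0r.
  by rewrite expr2 invfM mulrA divff// mul1r.
apply: measurable_funM => //; apply: measurable_funX.
apply: (measurableT_comp (@measurable_powR R (-1))).
exact: (measurableT_comp (@normr_measurable R setT)).
Qed.

Implicit Types f g : R -> R[i].

Lemma cmeasurableM f g : cmeasurable f -> cmeasurable g ->
  cmeasurable (fun k => f k * g k).
Proof.
move=> [f1 f2] [g1 g2]; split.
  under eq_fun do rewrite complex_ReM.
  by apply: measurable_funB; exact: measurable_funM.
under eq_fun do rewrite complex_ImM.
by apply: measurable_funD; exact: measurable_funM.
Qed.

Lemma cmeasurableD f g : cmeasurable f -> cmeasurable g ->
  cmeasurable (fun k => f k + g k).
Proof.
move=> [f1 f2] [g1 g2]; split.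
  under eq_fun do rewrite complex_ReD.
  by apply: measurable_funD.
under eq_fun do rewrite complex_ImD.
by apply: measurable_funD.
Qed.

Lemma measurable_csq f : cmeasurable f -> measurable_fun setT (fun k => csq (f k)).
Proof. by move=> [f1 f2]; apply: measurable_funD; exact: measurable_funX. Qed.

Lemma cmeasurableV f : cmeasurable f -> cmeasurable (fun k => (f k)^-1).
Proof.
move=> mf; have := measurable_funV (measurable_csq mf); case: mf => f1 f2 mV.
split.
  under eq_fun do rewrite complex_ReV.
  exact: measurable_funM.
under eq_fun do rewrite complex_ImV.
by apply: measurable_funN; exact: measurable_funM.
Qed.

Lemma cmeasurable_rc (f : R -> R) : measurable_fun setT f ->
  cmeasurable (fun k => rc (f k)).
Proof. by move=> mf; split. Qed.

Lemma cmeasurable_conj f : cmeasurable f -> cmeasurable (fun k => cconj (f k)).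
Proof. by move=> [f1 f2]; split => //=; exact: measurable_funN. Qed.

Lemma cmeasurable_rcB (f : R -> R) z : measurable_fun setT f ->
  cmeasurable (fun k => rc (f k) - z).
Proof.
move=> mf; apply: (@cmeasurableD (fun k => rc (f k)) (cst (- z))).
  exact: cmeasurable_rc.
by split.
Qed.

End complex_functions.

(** * Bounds on the multipliers, and the resolvent set off the interval *)

Section multiplier.
Variables (R : realType) (q : R).
Hypothesis q0 : 0 < q.
Local Notation leb := (@lebesgue_measure R).

(** Named so that it can be passed explicitly to [filterS]. *)
Lemma ae_lebesgue_filter : Filter (almost_everywhere leb).
Proof. exact: ae_filter_ringOfSetsType. Qed.

Lemma expR_abs_le1 (k : R) : expR (- (`|k| * q)) <= 1.
Proof. by rewrite -[leRHS]expR0 ler_expR oppr_le0 mulr_ge0// ltW. Qed.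

Lemma S1_ge0 k : 0 <= S1 q k.
Proof. by rewrite divr_ge0 ?mulr_ge0// subr_ge0 expR_abs_le1. Qed.

Lemma S2_ge0 k : 0 <= S2 q k.
Proof. by rewrite divr_ge0 ?mulr_ge0// addr_ge0// expR_ge0. Qed.

(** Division by zero returns 0, so [S1] and [S2] both vanish at [k = 0]; strict positivity holds
    only away from that point. *)
Lemma S1_gt0 k : k != 0 -> 0 < S1 q k.
Proof.
move=> k0; rewrite divr_gt0 ?mulr_gt0 ?normr_gt0// subr_gt0 -[ltRHS]expR0.
by rewrite ltr_expR oppr_lt0 mulr_gt0// normr_gt0.
Qed.

Lemma S2_gt0 k : k != 0 -> 0 < S2 q k.
Proof.
by move=> k0; rewrite divr_gt0 ?mulr_gt0 ?normr_gt0// addr_gt0// expR_gt0.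
Qed.

Lemma K1_bound k : - (1 / 2) <= K1 q k <= 1 / 2.
Proof.
have := expR_abs_le1 k; have := expR_ge0 (- (`|k| * q)); rewrite /K1 => *.
by apply/andP; split; lra.
Qed.

Lemma K2_bound k : - (1 / 2) <= K2 q k <= 1 / 2.
Proof.
have := expR_abs_le1 k; have := expR_ge0 (- (`|k| * q)); rewrite /K2 => *.
by apply/andP; split; lra.
Qed.

Lemma measurable_expR_abs : measurable_fun setT (fun k : R => expR (- (`|k| * q))).
Proof.
apply: (measurableT_comp (@measurable_expR R)); apply: measurable_funN.
by apply: measurable_funM => //; exact: normr_measurable.
Qed.

Lemma measurable_K1 : measurable_fun setT (K1 q).
Proof. by apply: measurable_funN; apply: measurable_funM => //; exact: measurable_expR_abs. Qed.

Lemma measurable_K2 : measurable_fun setT (K2 q).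
Proof. by apply: measurable_funM => //; exact: measurable_expR_abs. Qed.

Let measurable_half_inv : measurable_fun setT (fun k : R => (2 * `|k|)^-1).
Proof.
apply: measurable_funV; apply: measurable_funM => //; exact: normr_measurable.
Qed.

Lemma measurable_S1 : measurable_fun setT (S1 q).
Proof.
by apply: measurable_funM => //; apply: measurable_funB => //; exact: measurable_expR_abs.
Qed.

Lemma measurable_S2 : measurable_fun setT (S2 q).
Proof.
by apply: measurable_funM => //; apply: measurable_funD => //; exact: measurable_expR_abs.
Qed.

Lemma inK_energy_measurable (phi : pairfun R) :
    cmeasurable (fun k => (phi k).1) -> cmeasurable (fun k => (phi k).2) ->
  measurable_fun setT (fun k => S1 q k * csq (phi k).1 + S2 q k * csq (phi k).2).
Proof.
move=> m1 m2; apply: measurable_funD; apply: measurable_funM.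
- exact: measurable_S1.
- exact: (measurable_csq m1).
- exact: measurable_S2.
- exact: (measurable_csq m2).
Qed.

Lemma energy_ge0 (phi : pairfun R) k :
  0 <= S1 q k * csq (phi k).1 + S2 q k * csq (phi k).2.
Proof. by rewrite addr_ge0// mulr_ge0 ?S1_ge0 ?S2_ge0 ?csq_ge0. Qed.

Lemma NPshiftE z psi k : NPshift q z psi k =
  ((rc (K1 q k) - z) * (psi k).1, (rc (K2 q k) - z) * (psi k).2).
Proof. by rewrite /NPshift /= !mulrBl. Qed.

(** A bound [e] on the squared distance from [z] to the segment: the squared distance to the nearer
    endpoint when [z] is real, the square of the imaginary part otherwise. *)
Lemma csq_sub_gt (z : R[i]) :
    ~ (complex.Im z = 0 /\ - (1 / 2) <= complex.Re z <= 1 / 2) ->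
  exists2 e : R, 0 < e & forall a, - (1 / 2) <= a <= 1 / 2 -> e <= csq (rc a - z).
Proof.
case: z => x y /= h.
have [y0|y0] := eqVneq y 0.
  have [x1|x1] := ltP x (- (1 / 2)).
    exists ((x + 1 / 2) ^+ 2); first by rewrite exprn_even_gt0//=; apply/eqP; lra.
    by move=> a /andP[a1 a2]; rewrite /csq/=; nra.
  have [x2|x2] := leP x (1 / 2); first by exfalso; apply: h; rewrite x1 x2.
  exists ((x - 1 / 2) ^+ 2); first by rewrite exprn_even_gt0//=; apply/eqP; lra.
  by move=> a /andP[a1 a2]; rewrite /csq/=; nra.
exists (y ^+ 2); first by rewrite exprn_even_gt0.
by move=> a _; rewrite /csq/= sub0r sqrrN lerDr sqr_ge0.
Qed.

(** The factors [K1 - z] and [K2 - z] never vanish, so the equation is solved pointwise and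
    uniquely; dividing by them multiplies the energy by at most [1 / e]. *)
Lemma resolvent_point_off (z : R[i]) :
    ~ (complex.Im z = 0 /\ - (1 / 2) <= complex.Re z <= 1 / 2) ->
  resolvent_point q z.
Proof.
move=> /csq_sub_gt[e e0 he].
have d1 k := he _ (K1_bound k); have d2 k := he _ (K2_bound k).
have n1 k : rc (K1 q k) - z != 0 by rewrite -csq_eq0 gt_eqF// (lt_le_trans e0).
have n2 k : rc (K2 q k) - z != 0 by rewrite -csq_eq0 gt_eqF// (lt_le_trans e0).
split.
  move=> psi _; apply: (@filterS _ _ ae_lebesgue_filter) => k.
  rewrite NPshiftE /zerofun => -[/eqP + /eqP].
  rewrite !mulf_eq0 (negbTE (n1 k)) (negbTE (n2 k))/= => /eqP + /eqP.
  by case: (psi k) => a b /= -> ->.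
move=> phi [m1 [m2 phioo]].
pose psi : pairfun R := fun k =>
  ((rc (K1 q k) - z)^-1 * (phi k).1, (rc (K2 q k) - z)^-1 * (phi k).2).
have mp1 : cmeasurable (fun k => (psi k).1).
  apply: cmeasurableM m1; apply: cmeasurableV; apply: cmeasurable_rcB.
  exact: measurable_K1.
have mp2 : cmeasurable (fun k => (psi k).2).
  apply: cmeasurableM m2; apply: cmeasurableV; apply: cmeasurable_rcB.
  exact: measurable_K2.
exists psi; split; last first.
  apply: aeW => k; rewrite NPshiftE /psi/= !mulrA !divff// !mul1r.
  by case: (phi k).
split => //; split => //.
have mphi := inK_energy_measurable m1 m2.
apply: (@le_lt_trans _ _ (\int[leb]_(k in setT) (e^-1%:E *
    (S1 q k * csq (phi k).1 + S2 q k * csq (phi k).2)%:E))%E).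
  apply: ge0_le_integral => //.
  - by move=> k _; rewrite lee_fin energy_ge0.
  - by apply/measurable_EFinP; exact: inK_energy_measurable.
  - apply: emeasurable_funM => //; exact/measurable_EFinP.
  - move=> k _; rewrite -EFinM lee_fin /psi/= !csqM !csqV [leRHS]mulrDr.
    have i1 : (csq (rc (K1 q k) - z))^-1 <= e^-1.
      by rewrite lef_pV2 ?posrE// (lt_le_trans e0).
    have i2 : (csq (rc (K2 q k) - z))^-1 <= e^-1.
      by rewrite lef_pV2 ?posrE// (lt_le_trans e0).
    apply: lerD; rewrite mulrCA; apply: ler_wpM2r => //.
      by rewrite mulr_ge0 ?S1_ge0 ?csq_ge0.
    by rewrite mulr_ge0 ?S2_ge0 ?csq_ge0.
rewrite ge0_integralZl//; last 3 first.
- exact/measurable_EFinP.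
- by move=> k _; rewrite lee_fin energy_ge0.
- by rewrite lee_fin invr_ge0 ltW.
by apply: lte_mul_pinfty => //; rewrite lee_fin invr_ge0 ltW.
Qed.

End multiplier.

(** * Weights of infinite mass concentrated near a level of the profile *)

Section spectrum_inclusion.
Variables (R : realType) (q : R).
Hypothesis q0 : 0 < q.
Local Notation leb := (@lebesgue_measure R).

(** [w] is the energy density of a would-be preimage: not integrable, but integrable after
    multiplication by the squared deviation of the profile from [e]. Its support avoids 0 and the
    level set of [e], so that division by the weights and by [K - t] is legitimate there. *)
Definition blowup_weight (e : R) (w : R -> R) := [/\ measurable_fun setT w,
  forall k, 0 <= w k,
  forall k, w k != 0 -> 0 < k /\ expR (- (`|k| * q)) != e,
  (\int[leb]_(k in setT) (w k)%:E = +oo)%E &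
  (\int[leb]_(k in setT) ((expR (- (`|k| * q)) - e) ^+ 2 * w k)%:E < +oo)%E].

Lemma blowup_weight0 : exists w, blowup_weight 0 w.
Proof.
(* The profile approaches 0 only at infinity, so the infinite mass is placed there. *)
exists (\1_(`]0, +oo[%classic : set R)); split.
- exact: measurable_indic.
- by move=> k; rewrite indicE.
- move=> k; rewrite indicE pnatr_eq0 eqb0 negbK inE/= in_itv/= andbT => k0.
  by rewrite k0 gt_eqF// expR_gt0.
- by rewrite integral_indic//= setIT lebesgue_measure_itv/= ltry.
(* On the half-line the squared profile is [expR (- 2 q k)], which is [c] times the exponential
   density of rate [q + q]. *)
- pose c : R := (q + q)^-1.
  have c0 : 0 <= c by rewrite invr_ge0 addr_ge0// ltW.
  have qq : 0 < q + q by rewrite addr_gt0.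
  apply: (@le_lt_trans _ _ (\int[leb]_(k in setT)
      (c%:E * (exponential_pdf (q + q) k)%:E))%E).
    apply: ge0_le_integral => //.
    + apply/measurable_EFinP; apply: measurable_funM; last exact: measurable_indic.
      apply: measurable_funX; apply: measurable_funB => //.
      exact: measurable_expR_abs.
    + apply/measurable_EFinP; apply: measurable_funM => //.
      exact: measurable_exponential_pdf.
    + move=> k _; rewrite -EFinM lee_fin indicE.
      have [|] := boolP (k \in `]0, +oo[%classic); last first.
        by rewrite mulr0 mulr_ge0// exponential_pdf_ge0// ltW.
      rewrite inE/= in_itv/= andbT => k0.
      rewrite (exponential_pdfE _ (ltW k0)) mulr1 subr0 (ger0_norm (ltW k0)) mulrA.
      rewrite mulVf ?gt_eqF// mul1r expr2 -expRD. rewrite ler_expR.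
      by rewrite le_eqVlt; apply/orP; left; apply/eqP; ring.
  rewrite ge0_integralZl//=; last 2 first.
  + by apply/measurable_EFinP; exact: measurable_exponential_pdf.
  + by move=> k _; rewrite lee_fin exponential_pdf_ge0// ltW.
  by rewrite integral_exponential_pdf// mule1 ltry.
Qed.

(** On []a, a + b]] the integrand is at least [b^-2], so the integral is at least [b^-1] for every
    [0 < b <= 1]. *)
Lemma integral_inv_sqr_itv (a : R) :
  (\int[leb]_(k in setT) (((k - a)^-1 ^+ 2 * \1_(`]a, (a + 1)] : set R) k))%:E = +oo)%E.
Proof.
have mw : measurable_fun setT (fun k : R => (k - a)^-1 ^+ 2 * \1_(`]a, (a + 1)] : set R) k).
  apply: measurable_funM; last exact: measurable_indic.
  by apply: measurable_funX; apply: measurable_funV; exact: measurable_funB.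
apply/eqyP => n n0.
(* This makes the lower bound [n + 1], while [b <= 1] keeps the interval inside []a, a + 1]]. *)
pose b := (n + 1)^-1.
have n1 : 0 < n + 1 by rewrite addr_gt0.
have b0 : 0 < b by rewrite invr_gt0.
have b1 : b <= 1 by rewrite invf_le1// lerDr ltW.
apply: (@le_trans _ _ (\int[leb]_(k in setT)
   ((b^-1 ^+ 2)%:E * (\1_(`]a, (a + b)] : set R) k)%:E))%E).
  rewrite ge0_integralZl//; last 2 first.
  - by apply/measurable_EFinP; exact: measurable_indic.
  - by rewrite lee_fin sqr_ge0.
  rewrite integral_indic//= setIT lebesgue_measure_itv/= lte_fin ltrDl b0.
  rewrite -EFinB -EFinM lee_fin [a + b]addrC addrK expr2 -mulrA mulVf ?gt_eqF//.
  by rewrite mulr1 /b invrK lerDl.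
apply: ge0_le_integral => //.
- by move=> k _; rewrite -EFinM lee_fin mulr_ge0 ?sqr_ge0// indicE.
- by apply/measurable_EFinP; apply: measurable_funM => //; exact: measurable_indic.
- exact/measurable_EFinP.
- move=> k _; rewrite -EFinM lee_fin !indicE.
  have [|_] := boolP (k \in `]a, (a + b)]%classic); last first.
    by rewrite mulr0 mulr_ge0 ?sqr_ge0.
  rewrite inE/= in_itv/= => /andP[ak kb].
  rewrite mem_set/=; last by rewrite in_itv/= ak (le_trans kb)// lerD2l.
  have ka : 0 < k - a by rewrite subr_gt0.
  rewrite !mulr1; apply: lerXn2r; rewrite ?nnegrE ?invr_ge0 ?(ltW n1) ?(ltW ka)//.
  by rewrite lef_pV2 ?posrE// lerBlDl.
Qed.

(** The profile takes the value [e] at [a], which is nonnegative because [e <= 1]. The singularity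
    [(k - a)^-2] has infinite mass, but the profile is [q]-Lipschitz, so the squared deviation is at
    most [q^2 (k - a)^2] and cancels it. *)
Lemma blowup_weight_gt0 (e : R) : 0 < e <= 1 -> exists w, blowup_weight e w.
Proof.
move=> /andP[e0 e1]; pose a := - (ln e / q).
have a0 : 0 <= a by rewrite oppr_ge0 pmulr_lle0 ?invr_gt0// ln_le0.
have eE : e = expR (- (a * q)).
  by rewrite /a mulNr opprK divfK ?gt_eqF// lnK.
exists (fun k => (k - a)^-1 ^+ 2 * \1_(`]a, (a + 1)] : set R) k).
have mw : measurable_fun setT (fun k : R => (k - a)^-1 ^+ 2 * \1_(`]a, (a + 1)] : set R) k).
  apply: measurable_funM; last exact: measurable_indic.
  by apply: measurable_funX; apply: measurable_funV; exact: measurable_funB.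
split => //.
- by move=> k; rewrite mulr_ge0 ?sqr_ge0// indicE.
- move=> k; rewrite mulf_eq0 negb_or => /andP[_].
  rewrite indicE pnatr_eq0 eqb0 negbK inE/= in_itv/= => /andP[ak _].
  have k0 : 0 < k by exact: le_lt_trans ak.
  split=> //; rewrite (ger0_norm (ltW k0)) eE (inj_eq (@expR_inj R)) eqr_opp.
  by rewrite (inj_eq (mulIf _)) ?gt_eqF.
- exact: integral_inv_sqr_itv.
- apply: (@le_lt_trans _ _ (\int[leb]_(k in setT)
     ((q ^+ 2)%:E * (\1_(`]a, (a + 1)] : set R) k)%:E))%E); last first.
    rewrite ge0_integralZl//; last 2 first.
    + by apply/measurable_EFinP; exact: measurable_indic.
    + by rewrite lee_fin sqr_ge0.
    rewrite integral_indic//= setIT lebesgue_measure_itv/= lte_fin ltrDl ltr01.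
    by rewrite -EFinB -EFinM ltry.
  apply: ge0_le_integral => //.
  + by move=> k _; rewrite lee_fin mulr_ge0 ?sqr_ge0// mulr_ge0 ?sqr_ge0// indicE.
  + apply/measurable_EFinP; apply: measurable_funM => //.
    apply: measurable_funX; apply: measurable_funB => //.
    exact: measurable_expR_abs.
  + by apply/measurable_EFinP; apply: measurable_funM => //; exact: measurable_indic.
  + move=> k _; rewrite -EFinM lee_fin indicE.
    have [|_] := boolP (k \in `]a, (a + 1)]%classic); last by rewrite !mulr0.
    rewrite inE/= in_itv/= => /andP[ak _]; rewrite !mulr1.
    have k0 : 0 < k by exact: le_lt_trans ak.
    have ka : 0 < k - a by rewrite subr_gt0.
    rewrite (ger0_norm (ltW k0)) exprVn ler_pdivrMr ?exprn_gt0// -exprMn eE.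
    (* The profile decreases to the right of [a]; the sign is flipped so that both squared
       quantities are nonnegative. *)
    rewrite -sqrrN opprB; apply: lerXn2r; rewrite ?nnegrE ?mulr_ge0 ?(ltW q0) ?(ltW ka)//.
      by rewrite subr_ge0 ler_expR lerN2 ler_pM2r// ltW.
    have h : a * q <= k * q by rewrite ler_pM2r// ltW.
    apply: (le_trans (expR_sub_le (mulr_ge0 a0 (ltW q0)) h)).
    by rewrite -mulrBl mulrC.
Qed.

Lemma blowup_weight_ex (e : R) : 0 <= e <= 1 -> exists w, blowup_weight e w.
Proof.
move=> /andP[]; rewrite le_eqVlt => /orP[/eqP <- _|e0 e1].
  exact: blowup_weight0.
by apply: blowup_weight_gt0; rewrite e0.
Qed.

End spectrum_inclusion.

(** * Failure of surjectivity at the points of the interval *)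

Section spectrum_points.
Variables (R : realType) (q : R).
Hypothesis q0 : 0 < q.
Local Notation leb := (@lebesgue_measure R).

(** The square root is written as the power [2^-1], whose measurability is available through
    [measurable_powR]. *)
Lemma measurable_sqrt_quotient (S w : R -> R) :
  measurable_fun setT S -> measurable_fun setT w ->
  measurable_fun setT (fun k => (w k / S k) `^ 2^-1).
Proof.
move=> mS mw; apply: (measurableT_comp (measurable_powR 2^-1)).
by apply: measurable_funM => //; exact: measurable_funV.
Qed.

Lemma sqr_sqrt_quotient (S w : R -> R) k : 0 <= S k -> 0 <= w k ->
  (w k != 0 -> 0 < S k) -> S k * ((w k / S k) `^ 2^-1) ^+ 2 = w k.
Proof.
move=> S0 w0 wS; rewrite powR12_sqrt ?divr_ge0// sqr_sqrtr ?divr_ge0//.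
have [->|/wS Sk] := eqVneq (w k) 0; first by rewrite mul0r mulr0.
by rewrite mulrCA divff ?mulr1// gt_eqF.
Qed.

(** The boolean selects a component, so one argument covers [K1] for [t <= 0] and [K2] for
    [t > 0]. *)
Let S (b : bool) := if b then S1 q else S2 q.
Let K (b : bool) := if b then K1 q else K2 q.
Let comp (b : bool) (u : R[i]) : R[i] * R[i] := if b then (u, 0) else (0, u).
Let proj (b : bool) (p : R[i] * R[i]) : R[i] := if b then p.1 else p.2.

Lemma not_resolvent_of_weight (b : bool) (t : R) (w : R -> R) :
    measurable_fun setT w -> (forall k, 0 <= w k) ->
    (forall k, w k != 0 -> k != 0 /\ K b k != t) ->
    (\int[leb]_(k in setT) (w k)%:E = +oo)%E ->
    (\int[leb]_(k in setT) ((K b k - t) ^+ 2 * w k)%:E < +oo)%E ->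
  ~ resolvent_point q (rc t).
Proof.
move=> mw w0 wK woo Kwoo [_ surj].
have mS : measurable_fun setT (S b).
  by case: b {wK Kwoo}; [exact: measurable_S1|exact: measurable_S2].
have mK : measurable_fun setT (K b).
  by case: b {wK Kwoo mS}; [exact: measurable_K1|exact: measurable_K2].
have S0 k : 0 <= S b k.
  by case: b {wK Kwoo mS mK}; [exact: S1_ge0|exact: S2_ge0].
have wS k : w k != 0 -> 0 < S b k.
  move=> /wK[k0 _].
  by case: b {wK Kwoo mS mK S0}; [exact: S1_gt0|exact: S2_gt0].
pose h k := (w k / S b k) `^ 2^-1.
pose u k := rc ((K b k - t) * h k).
pose phi k := comp b (u k).
have mu : cmeasurable u.
  apply: cmeasurable_rc; apply: measurable_funM.
    exact: measurable_funB.
  exact: measurable_sqrt_quotient.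
have energy k : S1 q k * csq (phi k).1 + S2 q k * csq (phi k).2 = (K b k - t) ^+ 2 * w k.
  transitivity (S b k * csq (u k)).
    by rewrite /phi /comp; case: (b); rewrite /= csq0 mulr0 ?addr0 ?add0r.
  by rewrite csq_rc exprMn mulrCA sqr_sqrt_quotient//; exact: wS.
have phiK : inK q phi.
  split; [|split].
  - by rewrite /phi /comp; case: (b) => //=; split.
  - by rewrite /phi /comp; case: (b) => //=; split.
  - by under eq_integral do rewrite energy.
have [psi [[mp1 [mp2 psioo]] psiE]] := surj _ phiK.
(* A preimage [psi] would have energy at least the infinite mass of [w]. *)
suff : (\int[leb]_(k in setT) (w k)%:E <= \int[leb]_(k in setT)
    (S1 q k * csq (psi k).1 + S2 q k * csq (psi k).2)%:E)%E.
  by rewrite woo leye_eq => /eqP psiy; rewrite psiy in psioo.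
apply: ae_ge0_le_integral => //.
- by move=> k _; rewrite lee_fin.
- exact/measurable_EFinP.
- by move=> k _; rewrite lee_fin energy_ge0.
- by apply/measurable_EFinP; exact: inK_energy_measurable.
apply: (@filterS _ _ (ae_lebesgue_filter R) _ _ _ psiE) => k Hk _.
rewrite lee_fin.
have [->|wk0] := eqVneq (w k) 0; first exact: energy_ge0.
have [_ Kt] := wK _ wk0.
(* Where [w] is nonzero, [K - t] can be cancelled, which forces the selected component of [psi]. *)
have eu : proj b (psi k) = rc (h k).
  have Kt0 : rc (K b k) - rc t != 0.
    by rewrite -csq_eq0 /csq/= subrr expr0n/= addr0 sqrf_eq0 subr_eq0.
  apply: (mulfI Kt0).
  transitivity (u k).
    have := Hk; rewrite NPshiftE /phi /comp /proj.
    by rewrite /K; case: (b) => -[].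
  by rewrite /u; apply/eqP; rewrite eq_complex/=; apply/andP; split; apply/eqP; ring.
apply: (@le_trans _ _ (S b k * csq (proj b (psi k)))).
  by rewrite eu csq_rc sqr_sqrt_quotient//; exact: wS.
rewrite /S /proj; case: (b); [rewrite lerDl|rewrite lerDr];
  by rewrite mulr_ge0 ?csq_ge0 ?S1_ge0 ?S2_ge0.
Qed.

Lemma not_resolvent_point (t : R) : - (1 / 2) <= t <= 1 / 2 ->
  ~ resolvent_point q (rc t).
Proof.
move=> /andP[t1 t2].
have [b [e [e01 KE]]] : exists b e, 0 <= e <= 1 /\
    forall k, (K b k - t) ^+ 2 = 4^-1 * (expR (- (`|k| * q)) - e) ^+ 2.
  (* The sign of [t] decides which multiplier reaches it; the profile must then take the value
     [e = 2 |t|]. *)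
  have [t0|/ltW t0] := leP t 0; [exists true, (- 2 * t)|exists false, (2 * t)].
    by split=> [|k]; [apply/andP; split; lra|rewrite /K /K1; field].
  by split=> [|k]; [apply/andP; split; lra|rewrite /K /K2; field].
have [w [mw w0 wE woo Ewoo]] := blowup_weight_ex q0 e01.
apply: (@not_resolvent_of_weight b t w) => //.
  move=> k /wE[k0 Ee]; split; first by rewrite gt_eqF.
  by rewrite -subr_eq0 -sqrf_eq0 KE mulf_neq0 ?invr_eq0// sqrf_eq0 subr_eq0.
under eq_integral do rewrite KE -mulrA EFinM.
rewrite ge0_integralZl//.
- by apply: lte_mul_pinfty => //; rewrite lee_fin invr_ge0.
- apply/measurable_EFinP; apply: measurable_funM => //.
  by apply: measurable_funX; apply: measurable_funB => //; exact: measurable_expR_abs.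
- by move=> k _; rewrite lee_fin mulr_ge0 ?sqr_ge0.
Qed.

End spectrum_points.

(** * Construction of the spectral measures and their absolute continuity *)

Section spectral_measure.
Variables (R : realType) (q : R).
Hypothesis q0 : 0 < q.
Local Notation leb := (@lebesgue_measure R).

(** In fact an equality, put in the form that [exp_nonsingular] takes with [c = 1/2]. *)
Lemma K1_dist x y : 2^-1 * `|expR (- (`|x| * q)) - expR (- (`|y| * q))|
  <= `|K1 q x - K1 q y|.
Proof.
have -> : K1 q x - K1 q y =
    - (2^-1 * (expR (- (`|x| * q)) - expR (- (`|y| * q)))) by rewrite /K1; field.
by rewrite normrN normrM gtr0_norm.
Qed.

Lemma K2_dist x y : 2^-1 * `|expR (- (`|x| * q)) - expR (- (`|y| * q))|
  <= `|K2 q x - K2 q y|.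
Proof.
have -> : K2 q x - K2 q y =
    2^-1 * (expR (- (`|x| * q)) - expR (- (`|y| * q))) by rewrite /K2; field.
by rewrite normrM gtr0_norm.
Qed.

Lemma inK_integrable (phi : pairfun R) : inK q phi ->
  leb.-integrable setT (fun k => (S1 q k * csq (phi k).1)%:E) /\
  leb.-integrable setT (fun k => (S2 q k * csq (phi k).2)%:E).
Proof.
move=> [m1 [m2 phioo]].
have F1 k : 0 <= S1 q k * csq (phi k).1 by rewrite mulr_ge0 ?S1_ge0 ?csq_ge0.
have F2 k : 0 <= S2 q k * csq (phi k).2 by rewrite mulr_ge0 ?S2_ge0 ?csq_ge0.
have M1 : measurable_fun setT (fun k => S1 q k * csq (phi k).1).
  by apply: measurable_funM; [exact: measurable_S1|exact: (measurable_csq m1)].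
have M2 : measurable_fun setT (fun k => S2 q k * csq (phi k).2).
  by apply: measurable_funM; [exact: measurable_S2|exact: (measurable_csq m2)].
split; apply/integrableP; split; try exact/measurable_EFinP.
- apply: le_lt_trans phioo; apply: ge0_le_integral => //.
  + by apply: measurableT_comp => //; exact/measurable_EFinP.
  + by apply/measurable_EFinP; exact: inK_energy_measurable.
  + by move=> k _; rewrite gee0_abs lee_fin// lerDl.
- apply: le_lt_trans phioo; apply: ge0_le_integral => //.
  + by apply: measurableT_comp => //; exact/measurable_EFinP.
  + by apply/measurable_EFinP; exact: inK_energy_measurable.
  + by move=> k _; rewrite gee0_abs lee_fin// lerDr.
Qed.

Lemma rcM (a b : R) : rc (a * b) = rc a * rc b.
Proof. by apply/eqP; rewrite eq_complex/= !mulr0 mul0r subr0 addr0 !eqxx. Qed.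

Lemma Im_rcB (a : R) z : complex.Im (rc a - z) = - complex.Im z.
Proof. by case: z => x y /=; rewrite sub0r. Qed.

(** For real [t], [|t - z| >= |Im z|]. Real and imaginary parts are separated because
    [pushforward_density2] integrates real functions. *)
Lemma bounded_resolvent (z : R[i]) : complex.Im z != 0 ->
  [bounded complex.Re ((rc t - z)^-1) | t in [set: R]] /\
  [bounded complex.Im ((rc t - z)^-1) | t in [set: R]].
Proof.
move=> z0; have c0 : 0 < complex.Im z ^+ 2 by rewrite exprn_even_gt0.
have le t : csq ((rc t - z)^-1) <= (`|complex.Im z|^-1) ^+ 2.
  rewrite csqV exprVn real_normK ?num_real// lef_pV2 ?posrE//.
    by rewrite /csq Im_rcB sqrrN lerDr sqr_ge0.
  rewrite (lt_le_trans c0)// /csq Im_rcB sqrrN lerDr sqr_ge0//.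
have b (x : R) t : `|x| ^+ 2 <= csq ((rc t - z)^-1) -> `|x| <= `|complex.Im z|^-1.
  by move=> /le_trans /(_ (le t)); rewrite ler_sqr ?nnegrE ?invr_ge0.
by split; exists (`|complex.Im z|^-1); (split; first exact: num_real);
  move=> M /ltW hM t _ /=; apply: (le_trans _ hM); apply: (b _ t);
  [exact: csq_ge_Re|exact: csq_ge_Im].
Qed.

Lemma only_ac_spectrum_NP : only_ac_spectrum q.
Proof.
move=> phi phiK; have [i1 i2] := inK_integrable phiK.
pose F1 k := (S1 q k * csq (phi k).1); pose F2 k := (S2 q k * csq (phi k).2).
(* The measure is fixed before [z], with an integral formula for all bounded measurable [g]. *)
have [mu [mac muE]] : exists mu : {finite_measure set R -> \bar R}, mu `<< leb /\
    forall g : R -> R, measurable_fun setT g ->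
      [bounded g x | x in [set: R]] ->
      (\int[mu]_x (g x)%:E =
       \int[leb]_x ((g (K1 q x))%:E * (F1 x)%:E + (g (K2 q x))%:E * (F2 x)%:E))%E.
  apply: pushforward_density2 => //.
  - by move=> k; rewrite lee_fin mulr_ge0 ?S1_ge0 ?csq_ge0.
  - by move=> k; rewrite lee_fin mulr_ge0 ?S2_ge0 ?csq_ge0.
  - exact: measurable_K1.
  - exact: measurable_K2.
  - move=> A _ A0; apply: (exp_nonsingular q0 _ K1_dist A0).
    by rewrite invr_gt0.
  - move=> A _ A0; apply: (exp_nonsingular q0 _ K2_dist A0).
    by rewrite invr_gt0.
exists mu; split => // z z0 psi psiK psiE.
have [bRe bIm] := bounded_resolvent z0.
have [mRe mIm] : cmeasurable (fun t : R => (rc t - z)^-1).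
  by apply: cmeasurableV; exact: cmeasurable_rcB.
have n a : rc a - z != 0.
  rewrite eq_complex negb_and; apply/orP; right.
  by rewrite Im_rcB oppr_eq0.
have mpsi : cmeasurable (fun k => rc (S1 q k) * (psi k).1 * cconj (phi k).1
                   + rc (S2 q k) * (psi k).2 * cconj (phi k).2).
  have [p1 [p2 _]] := psiK; have [f1 [f2 _]] := phiK.
  apply: cmeasurableD; apply: cmeasurableM; try exact: cmeasurable_conj.
  - by apply: cmeasurableM => //; apply: cmeasurable_rc; exact: measurable_S1.
  - by apply: cmeasurableM => //; apply: cmeasurable_rc; exact: measurable_S2.
have mF1 : measurable_fun setT F1 by apply/measurable_EFinP; exact: measurable_int i1.
have mF2 : measurable_fun setT F2 by apply/measurable_EFinP; exact: measurable_int i2.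
(* Almost everywhere [psi = (K - z)^-1 phi], so each term [S psi conj(phi)] becomes
   [(K - z)^-1 S |phi|^2]. *)
have ae : {ae leb, forall k, rc (S1 q k) * (psi k).1 * cconj (phi k).1
                   + rc (S2 q k) * (psi k).2 * cconj (phi k).2 =
     (rc (K1 q k) - z)^-1 * rc (F1 k) + (rc (K2 q k) - z)^-1 * rc (F2 k)}.
  apply: (@filterS _ _ (ae_lebesgue_filter R) _ _ _ psiE) => k.
  rewrite NPshiftE; case E : (phi k) => [f1 f2] -[e1 e2].
  have r1 : rc (F1 k) = rc (S1 q k) * (f1 * cconj f1).
    by rewrite mul_cconj /F1 E rcM.
  have r2 : rc (F2 k) = rc (S2 q k) * (f2 * cconj f2).
    by rewrite mul_cconj /F2 E rcM.
  rewrite r1 r2 /= -{1}(mulKf (n (K1 q k)) (psi k).1) e1.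
  rewrite -{1}(mulKf (n (K2 q k)) (psi k).2) e2; ring.
have mg (g : R -> R) (K : R -> R) F : measurable_fun setT g -> measurable_fun setT K ->
    measurable_fun setT F -> measurable_fun setT (fun k => (g (K k))%:E * (F k)%:E)%E.
  move=> mg mK mF; apply/measurable_EFinP; apply: measurable_funM => //.
  exact: (measurableT_comp mg mK).
(* The integral formula is applied with [g] the real part, then the imaginary part, of
   [t -> (t - z)^-1]. *)
rewrite /ipK /cint /Rintegral; congr (Complex (fine _) (fine _)).
- rewrite (muE _ mRe bRe); apply: (ae_eq_integral (mu := leb)) => //.
  + by apply/measurable_EFinP; case: mpsi.
  + apply: emeasurable_funD.
      exact: (mg _ _ _ mRe (measurable_K1 q) mF1).
    exact: (mg _ _ _ mRe (measurable_K2 q) mF2).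
  + apply: (@filterS _ _ (ae_lebesgue_filter R) _ _ _ ae) => k -> _.
    by rewrite -!EFinM -EFinD complex_ReD !complex_ReM /= !mulr0 !subr0.
- rewrite (muE _ mIm bIm); apply: (ae_eq_integral (mu := leb)) => //.
  + by apply/measurable_EFinP; case: mpsi.
  + apply: emeasurable_funD.
      exact: (mg _ _ _ mIm (measurable_K1 q) mF1).
    exact: (mg _ _ _ mIm (measurable_K2 q) mF2).
  + apply: (@filterS _ _ (ae_lebesgue_filter R) _ _ _ ae) => k -> _.
    by rewrite -!EFinM -EFinD complex_ImD !complex_ImM /= !mulr0 !add0r.
Qed.

End spectral_measure.

Theorem theorem3p7 (R : realType) (r Rad : R) (hr : 0 < r) (hrR : r < Rad) :
  only_ac_spectrum (qpar r Rad) /\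
  NPspectrum (qpar r Rad) = [set z : R[i] | complex.Im z = 0 /\ -(1/2) <= complex.Re z <= 1/2].
Proof.
have q0 : 0 < qpar r Rad.
  have hR := lt_trans hr hrR.
  by rewrite subr_gt0 ltf_pV2 ?posrE ?mulr_gt0// ltr_pM2l.
split; first exact: only_ac_spectrum_NP.
apply/seteqP; split => z /=.
  (* By contraposition: a point off the interval is a resolvent point. *)
  by move=> nz; apply: contrapT => /(resolvent_point_off q0).
case: z => x y /= [-> x12]; exact: not_resolvent_point.
Qed.
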